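(* Let $\gamma>1$, let $v_-<v_+$ and $\rho_\pm>0$ be real constants. For $\kappa>0$, let $(\rho_*^\kappa,\rho_*^\kappa v_*^\kappa)$ be the intermediate state of a solution $(\rho^\kappa,\rho^\kappa v^\kappa)$ of the isentropic Euler equations with pressure $p(\rho)=\kappa\rho^\gamma$ and Riemann data $(\rho,v)(x,0)=(\rho_\pm,v_\pm)$ for $\pm x>0$, in the sense that $v_-$ and $v_*^\kappa$ are connected by a $1$-rarefaction wave, and $v_*^\kappa$ and $v_+$ are connected by a $2$-shock wave (which implies $\rho_->\rho_+$). Then $$v_-<v_*^\kappa<v_+\quad\text{for all }\kappa\in(0,\kappa_{rs}),$$ and $$v_*^\kappa=v_+\iff\kappa=\kappa_{rs}:=\left(\frac{(v_+-v_-)(\gamma-1)}{2\sqrt{\gamma}\,\big(\rho_-^{\frac{\gamma-1}{2}}-\rho_+^{\frac{\gamma-1}{2}}\big)}\right)^2.$$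
   Context: The isentropic Euler equations are $\partial_t\rho+\partial_x(\rho v)=0$, $\partial_t(\rho v)+\partial_x(\rho v^2+p)=0$, where $\rho>0$ is the density, $v$ the velocity, and $p=p(\rho)=\kappa\rho^\gamma$ the pressure, with $\kappa>0$, $\gamma>1$. A state $(\rho_*^\kappa,v_*^\kappa)$ that is connected to the left state $(\rho_-,v_-)$ by a $1$-rarefaction wave satisfies $$v_*^\kappa=v_-+\frac{2\sqrt{\kappa\gamma}}{\gamma-1}\big(\rho_-^{\frac{\gamma-1}{2}}-(\rho_*^\kappa)^{\frac{\gamma-1}{2}}\big),\qquad \rho_*^\kappa<\rho_-.$$ A state $(\rho_*^\kappa,v_*^\kappa)$ that is connected to the right state $(\rho_+,v_+)$ by a $2$-shock wave (Rankine–Hugoniot conditions together with Lax's entropy conditions) satisfies $$v_*^\kappa=v_++\sqrt{\frac{\kappa\big(\rho_+^\gamma-(\rho_*^\kappa)^\gamma\big)}{\rho_+\rho_*^\kappa(\rho_+-\rho_*^\kappa)}}\,(\rho_*^\kappa-\rho_+),\qquad \rho_*^\kappa>\rho_+.$$ The intermediate state $(\rho_*^\kappa,v_*^\kappa)$ is determined by these two relations. *)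

(* Defs.v *)
From Stdlib Require Import Reals.
Open Scope R_scope.

(** Isentropic Euler equations with [p(rho) = kappa * rho ^ gamma]. States are
    pairs (density, velocity); every density below is positive, so [Rpower] is
    the usual real power. *)

(** The state [(rs, vs)] is connected to the left state [(rm, vm)] by a
    1-rarefaction wave. *)
Definition rarefaction1 (gamma kappa rm vm rs vs : R) : Prop :=
  0 < rs /\ rs < rm /\
  vs = vm + 2 * sqrt (kappa * gamma) / (gamma - 1)
            * (Rpower rm ((gamma - 1) / 2) - Rpower rs ((gamma - 1) / 2)).

(** The velocity relation of the 2-shock curve through the right state
    [(rp, vp)], without the admissibility inequality [rp < rs]. The quotient is
    meaningless at [rs = rp], but it is then multiplied by [0], so that the
    relation reads [vs = vp] (a shock of zero strength). *)
Definition shock_curve2 (gamma kappa rp vp rs vs : R) : Prop :=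
  vs = vp + sqrt (kappa * (Rpower rp gamma - Rpower rs gamma)
                  / (rp * rs * (rp - rs))) * (rs - rp).

(** Admissible 2-shock: Lax's entropy conditions select [rp < rs]. *)
Definition shock2 (gamma kappa rp vp rs vs : R) : Prop :=
  rp < rs /\ shock_curve2 gamma kappa rp vp rs vs.

Definition kappa_rs (gamma rm vm rp vp : R) : R :=
  ((vp - vm) * (gamma - 1)
   / (2 * sqrt gamma
      * (Rpower rm ((gamma - 1) / 2) - Rpower rp ((gamma - 1) / 2)))) ^ 2.

(* Main.v *)
Require Import Defs.
From Stdlib Require Import Reals Lra.
Open Scope R_scope.

(** Why the theorem holds.

    Both wave curves are monotone in the intermediate density, in opposite
    directions. Along the shock curve, [vs - vp] has the sign of [rs - rp],
    because [r |-> r ^ gamma] is increasing and so the square root is positive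
    ([shock_curve2_lt], [shock_curve2_gt]). Along the rarefaction curve the
    velocity strictly decreases with the density ([rarefaction_speed_decr]).
    The two curves therefore meet at [rs = rp] exactly when the rarefaction
    curve takes the value [vp] at the density [rp].

    This last condition determines [kappa]. The velocity gain from [rm] down to
    [rp] increases strictly with [kappa] ([rarefaction_speed_mono]), and
    [kappa_rs] is the pressure constant for which it equals [vp - vm]
    ([rarefaction_speed_kappa_rs]).

    Hence the signs of [rs - rp], [vs - vp] and [kappa - kappa_rs] coincide
    ([intermediate_state_trichotomy]), and every claim is read off from that.
    The bound [vm < vs] is the monotonicity of the rarefaction curve alone.
    An admissible shock, with [rp < rs], occurs only for [kappa_rs < kappa] and
    [vp < vs]: for it the claim about [kappa < kappa_rs] is vacuous, and both
    sides of the equivalence are false. *)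

(** Velocity gained along the 1-rarefaction curve from density [rm] to [r]. *)
Definition rarefaction_speed (gamma kappa rm r : R) : R :=
  2 * sqrt (kappa * gamma) / (gamma - 1)
  * (Rpower rm ((gamma - 1) / 2) - Rpower r ((gamma - 1) / 2)).

Lemma Rpower_lt_base (a x y : R) :
  0 < a -> 0 < x -> x < y -> Rpower x a < Rpower y a.
Proof.
  intros ha hx hxy. unfold Rpower.
  apply exp_increasing, Rmult_lt_compat_l; [exact ha|].
  now apply ln_increasing.
Qed.

Lemma rarefaction_coef_pos (gamma kappa : R) :
  1 < gamma -> 0 < kappa -> 0 < 2 * sqrt (kappa * gamma) / (gamma - 1).
Proof.
  intros hg hk. apply Rdiv_lt_0_compat; [|lra].
  apply Rmult_lt_0_compat; [lra|].
  apply sqrt_lt_R0, Rmult_lt_0_compat; lra.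
Qed.

Lemma rarefaction_speed_decr (gamma kappa rm r1 r2 : R) :
  1 < gamma -> 0 < kappa -> 0 < r1 -> r1 < r2 ->
  rarefaction_speed gamma kappa rm r2 < rarefaction_speed gamma kappa rm r1.
Proof.
  intros hg hk h1 h12. unfold rarefaction_speed.
  apply Rmult_lt_compat_l; [now apply rarefaction_coef_pos|].
  assert (H := Rpower_lt_base ((gamma - 1) / 2) r1 r2 ltac:(lra) h1 h12). lra.
Qed.

Lemma rarefaction_speed_mono (gamma k1 k2 rm r : R) :
  1 < gamma -> 0 <= k1 -> k1 < k2 -> 0 < r -> r < rm ->
  rarefaction_speed gamma k1 rm r < rarefaction_speed gamma k2 rm r.
Proof.
  intros hg h1 h12 hr hrm. unfold rarefaction_speed.
  assert (H := Rpower_lt_base ((gamma - 1) / 2) r rm ltac:(lra) hr hrm).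
  apply Rmult_lt_compat_r; [lra|].
  apply Rmult_lt_compat_r; [apply Rinv_0_lt_compat; lra|].
  apply Rmult_lt_compat_l; [lra|].
  apply sqrt_lt_1_alt. split.
  - apply Rmult_le_pos; lra.
  - apply Rmult_lt_compat_r; lra.
Qed.

(** The formula for [kappa_rs] is this equation solved for [kappa]. The squared
    quotient in it is positive, since [vm < vp] and [rp < rm], and so it is the
    square root of [kappa_rs]; the rest is cancellation. *)
Lemma rarefaction_speed_kappa_rs (gamma rm vm rp vp : R) :
  1 < gamma -> vm < vp -> 0 < rp -> rp < rm ->
  rarefaction_speed gamma (kappa_rs gamma rm vm rp vp) rm rp = vp - vm.
Proof.
  intros hg hv hrp hr. unfold rarefaction_speed, kappa_rs.
  assert (H := Rpower_lt_base ((gamma - 1) / 2) rp rm ltac:(lra) hrp hr).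
  set (d := Rpower rm _ - Rpower rp _) in *.
  assert (hd : 0 < d) by (unfold d; lra).
  assert (hs : 0 < sqrt gamma) by (apply sqrt_lt_R0; lra).
  set (q := (vp - vm) * (gamma - 1) / (2 * sqrt gamma * d)).
  assert (hq : 0 < q).
  { apply Rdiv_lt_0_compat; repeat apply Rmult_lt_0_compat; lra. }
  rewrite sqrt_mult_alt by (apply pow_le; lra).
  rewrite sqrt_pow2 by lra.
  unfold q. field. lra.
Qed.

Lemma kappa_rs_nonneg (gamma rm vm rp vp : R) : 0 <= kappa_rs gamma rm vm rp vp.
Proof. apply pow2_ge_0. Qed.

(** The Rankine-Hugoniot radicand is a difference quotient of the increasing
    function [r |-> r ^ gamma], symmetric in the two densities. *)
Lemma shock_radicand_pos (gamma kappa r1 r2 : R) :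
  1 < gamma -> 0 < kappa -> 0 < r1 -> 0 < r2 -> r1 <> r2 ->
  0 < kappa * (Rpower r1 gamma - Rpower r2 gamma) / (r1 * r2 * (r1 - r2)).
Proof.
  intros hg hk.
  assert (Hlt : forall x y, 0 < x -> x < y ->
    0 < kappa * (Rpower y gamma - Rpower x gamma) / (y * x * (y - x))).
  { intros x y hx hxy.
    assert (H := Rpower_lt_base gamma x y ltac:(lra) hx hxy).
    apply Rdiv_lt_0_compat; repeat apply Rmult_lt_0_compat; lra. }
  intros h1 h2 hne.
  destruct (Rtotal_order r1 r2) as [h|[h|h]]; [|contradiction|now apply Hlt].
  replace (_ / _) with
    (kappa * (Rpower r2 gamma - Rpower r1 gamma) / (r2 * r1 * (r2 - r1)))
    by (field; lra).
  now apply Hlt.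
Qed.

Lemma shock_curve2_lt (gamma kappa rp vp rs vs : R) :
  1 < gamma -> 0 < kappa -> 0 < rs -> rs < rp ->
  shock_curve2 gamma kappa rp vp rs vs -> vs < vp.
Proof.
  intros hg hk hrs hlt ->.
  assert (H := sqrt_lt_R0 _ (shock_radicand_pos gamma kappa rp rs hg hk
                 ltac:(lra) hrs ltac:(lra))).
  assert (H' := Rmult_lt_0_compat _ (rp - rs) H ltac:(lra)). lra.
Qed.

Lemma shock_curve2_gt (gamma kappa rp vp rs vs : R) :
  1 < gamma -> 0 < kappa -> 0 < rp -> rp < rs ->
  shock_curve2 gamma kappa rp vp rs vs -> vp < vs.
Proof.
  intros hg hk hrp hlt ->.
  assert (H := sqrt_lt_R0 _ (shock_radicand_pos gamma kappa rp rs hg hk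
                 hrp ltac:(lra) ltac:(lra))).
  assert (H' := Rmult_lt_0_compat _ (rs - rp) H ltac:(lra)). lra.
Qed.

Lemma rarefaction1_velocity_gt (gamma kappa rm vm rs vs : R) :
  1 < gamma -> 0 < kappa -> rarefaction1 gamma kappa rm vm rs vs -> vm < vs.
Proof.
  intros hg hk (hrs & hlt & ->).
  assert (H := rarefaction_speed_decr gamma kappa rm rs rm hg hk hrs hlt).
  unfold rarefaction_speed in H.
  rewrite Rminus_diag, Rmult_0_r in H. lra.
Qed.

(** The velocity gain at density [rp] is strictly increasing in the pressure
    constant and equals [vp - vm] at [kappa_rs], so comparing gains amounts to
    comparing constants. *)
Lemma kappa_rs_compare (gamma kappa rm vm rp vp : R) :
  1 < gamma -> vm < vp -> 0 < rp -> rp < rm -> 0 < kappa ->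
  let w := rarefaction_speed gamma kappa rm rp in
  (w < vp - vm -> kappa < kappa_rs gamma rm vm rp vp) /\
  (w = vp - vm -> kappa = kappa_rs gamma rm vm rp vp) /\
  (vp - vm < w -> kappa_rs gamma rm vm rp vp < kappa).
Proof.
  intros hg hv hrp hr hk w.
  assert (E := rarefaction_speed_kappa_rs gamma rm vm rp vp hg hv hrp hr).
  assert (P := kappa_rs_nonneg gamma rm vm rp vp).
  set (k0 := kappa_rs gamma rm vm rp vp) in *.
  unfold w. rewrite <- E.
  destruct (Rtotal_order kappa k0) as [h|[h|h]].
  - assert (H := rarefaction_speed_mono gamma kappa k0 rm rp hg
                   ltac:(lra) h hrp hr).
    repeat split; intros; lra.
  - rewrite h. repeat split; intros; lra.
  - assert (H := rarefaction_speed_mono gamma k0 kappa rm rp hg P h hrp hr).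
    repeat split; intros; lra.
Qed.

(** Write [w r] for the velocity gain at density [r], so that [w rs = vs - vm].
    If [rs < rp], then [w rp < w rs] along the rarefaction curve and
    [vs < vp] along the shock curve, whence [w rp < vp - vm], that is,
    [kappa < kappa_rs]. The other two cases are the same with [=] or [>]. *)
Lemma intermediate_state_trichotomy (gamma kappa rm vm rp vp rs vs : R) :
  1 < gamma -> vm < vp -> 0 < rp -> rp < rm -> 0 < kappa ->
  rarefaction1 gamma kappa rm vm rs vs ->
  shock_curve2 gamma kappa rp vp rs vs ->
  let k0 := kappa_rs gamma rm vm rp vp in
  (rs < rp /\ vs < vp /\ kappa < k0) \/
  (rs = rp /\ vs = vp /\ kappa = k0) \/
  (rp < rs /\ vp < vs /\ k0 < kappa).
Proof.
  intros hg hv hrp hr hk (hrs & _ & hvs) hS k0.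
  fold (rarefaction_speed gamma kappa rm rs) in hvs.
  destruct (kappa_rs_compare gamma kappa rm vm rp vp hg hv hrp hr hk)
    as (Hlt & Heq & Hgt).
  destruct (Rtotal_order rs rp) as [h|[h|h]].
  - left.
    assert (A := shock_curve2_lt _ _ _ _ _ _ hg hk hrs h hS).
    assert (B := rarefaction_speed_decr gamma kappa rm rs rp hg hk hrs h).
    repeat split; [exact h|exact A|apply Hlt; lra].
  - right; left. subst rs.
    assert (A : vs = vp)
      by (unfold shock_curve2 in hS; rewrite Rminus_diag, Rmult_0_r in hS; lra).
    repeat split; [exact A|apply Heq; lra].
  - right; right.
    assert (A := shock_curve2_gt _ _ _ _ _ _ hg hk hrp h hS).
    assert (B := rarefaction_speed_decr gamma kappa rm rp rs hg hk hrp h).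
    repeat split; [exact h|exact A|apply Hgt; lra].
Qed.

(* The first conjunct takes an admissible 2-shock, which forces vp < vs. The
   second takes the two velocity relations alone, with rp < rm assumed instead
   of deduced, so that the range kappa <= kappa_rs is covered. *)
Theorem lemma4p1 (gamma vm vp rm rp : R)
    (hgamma : 1 < gamma) (hv : vm < vp) (hrm : 0 < rm) (hrp : 0 < rp) :
  (forall kappa rs vs : R,
     0 < kappa ->
     rarefaction1 gamma kappa rm vm rs vs ->
     shock2 gamma kappa rp vp rs vs ->
     rp < rm /\
     (kappa < kappa_rs gamma rm vm rp vp -> vm < vs < vp) /\
     (vs = vp <-> kappa = kappa_rs gamma rm vm rp vp))
  /\
  (rp < rm ->
   forall kappa rs vs : R,
     0 < kappa ->
     rarefaction1 gamma kappa rm vm rs vs ->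
     shock_curve2 gamma kappa rp vp rs vs ->
     (kappa < kappa_rs gamma rm vm rp vp -> vm < vs < vp) /\
     (vs = vp <-> kappa = kappa_rs gamma rm vm rp vp)).
Proof.
  assert (Hcurve : rp < rm -> forall kappa rs vs : R, 0 < kappa ->
     rarefaction1 gamma kappa rm vm rs vs ->
     shock_curve2 gamma kappa rp vp rs vs ->
     (kappa < kappa_rs gamma rm vm rp vp -> vm < vs < vp) /\
     (vs = vp <-> kappa = kappa_rs gamma rm vm rp vp)).
  { intros hr kappa rs vs hk hR hS.
    assert (L := rarefaction1_velocity_gt _ _ _ _ _ _ hgamma hk hR).
    assert (T := intermediate_state_trichotomy
                   _ _ _ _ _ _ _ _ hgamma hv hrp hr hk hR hS).
    cbv zeta in T. repeat split; intros; lra. }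
  split; [|exact Hcurve].
  intros kappa rs vs hk hR [hlt hS].
  assert (hr : rp < rm) by (destruct hR as (_ & h & _); lra).
  split; [exact hr|].
  exact (Hcurve hr kappa rs vs hk hR hS).
Qed.
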